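(* For every integer $k\ge 0$, $$\overline{pp}(2\cdot 13^k)\equiv 3(k+1)\pmod 9.$$
   Context: For $|q|<1$, $(a;q)_\infty=\prod_{k=1}^\infty(1-aq^{k-1})$. An overpartition of $n$ is a partition of $n$ in which the first occurrence of each number may be overlined; there is exactly one overpartition of $0$ (the empty one). An overpartition pair of $n$ is an ordered pair $(\lambda,\mu)$ of overpartitions such that the sum of all parts of $\lambda$ and $\mu$ is $n$ (either may be the overpartition of $0$). $\overline{pp}(n)$ denotes the number of overpartition pairs of $n$; its generating function is $\sum_{n\ge 0}\overline{pp}(n)q^n=(-q;q)_\infty^2/(q;q)_\infty^2$. *)

(* Defs.v *)
From HB Require Import structures.
From mathcomp Require Import all_boot.

Set Implicit Arguments.
Unset Strict Implicit.
Unset Printing Implicit Defensive.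

(* A part is a pair (a, o) with a its size and o true iff it is overlined. *)
Definition parts (s : seq (nat * bool)) : seq nat := unzip1 s.

Definition weight (s : seq (nat * bool)) : nat := sumn (parts s).

(* Parts are listed in non-increasing order; the last conjunct says that an
   overlined part is the first occurrence of its size. *)
Definition is_overpartition (s : seq (nat * bool)) : bool :=
  [&& sorted geq (parts s),
      all (fun a => 0 < a) (parts s)
    & all (fun i => nth false (unzip2 s) i ==>
                    (nth 0 (parts s) i \notin take i (parts s)))
          (iota 0 (size s))].

Definition is_overpartition_pair (n : nat)
    (p : seq (nat * bool) * seq (nat * bool)) : bool :=
  [&& is_overpartition p.1, is_overpartition p.2
    & weight p.1 + weight p.2 == n].

(* Sequences of length at most n with parts at most n; the lemmas below show
   that these bounds lose no overpartition pair of n. *)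
Definition bounded_seq (n : nat) := {bseq n of 'I_n.+1 * bool}.

Definition forget (n : nat) (s : bounded_seq n) : seq (nat * bool) :=
  [seq (val x.1, x.2) | x <- s].

Definition pp (n : nat) : nat :=
  #|[set p : bounded_seq n * bounded_seq n |
      is_overpartition_pair n (forget p.1, forget p.2)]|.

Lemma forget_inj n : injective (@forget n).
Proof.
move=> s t; rewrite /forget => /inj_map e; apply/val_inj/e.
by move=> [a b] [c d] /= [/val_inj -> ->].
Qed.

Lemma forget_surj n s :
  is_overpartition s -> weight s <= n -> exists t : bounded_seq n, forget t = s.
Proof.
case/and3P=> _ pos _ wn.
have sz : size s <= n.
  apply: leq_trans wn; rewrite /weight.
  elim: s pos => //= x s IH /andP[x0 /IH h].
  by rewrite -add1n leq_add.
have bd : all (fun x => x.1 <= n) s.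
  apply/allP => x xs; apply: leq_trans wn.
  elim: s xs {pos sz} => //= y s IH; rewrite inE /weight /=.
  case/predU1P=> [->|/IH h]; first exact: leq_addr.
  exact: leq_trans h (leq_addl _ _).
pose f (x : nat * bool) : 'I_n.+1 * bool := (inord x.1, x.2).
have szf : size (map f s) <= n by rewrite size_map.
exists (Bseq szf); rewrite /forget /= -map_comp -[RHS]map_id.
apply/eq_in_map => -[a b] /(allP bd) /= an.
by rewrite inordK.
Qed.

Lemma ppP (n : nat) : exists s : seq (seq (nat * bool) * seq (nat * bool)),
  [/\ uniq s, forall p, (p \in s) = is_overpartition_pair n p & size s = pp n].
Proof.
pose A := [set p : bounded_seq n * bounded_seq n |
            is_overpartition_pair n (forget p.1, forget p.2)].
exists [seq (forget p.1, forget p.2) | p <- enum A]; split.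
- rewrite map_inj_uniq ?enum_uniq //.
  by move=> [a b] [c d] /= [/forget_inj -> /forget_inj ->].
- move=> [a b]; apply/mapP/idP => [[p + ->]|ab].
    by rewrite mem_enum inE.
  have /and3P[/= oa ob /eqP w] := ab.
  have wa : weight a <= n by rewrite -w leq_addr.
  have wb : weight b <= n by rewrite -w leq_addl.
  have [a' ea] := forget_surj oa wa; have [b' eb] := forget_surj ob wb.
  by exists (a', b') => /=; rewrite ?ea ?eb // mem_enum inE /= ea eb.
- by rewrite size_map -cardE.
Qed.

(* Main.v *)
Require Import Defs.
From mathcomp Require Import all_boot.
From HB Require Import structures.
From mathcomp Require Import all_order all_algebra.
From mathcomp Require Import boolp zify ring lra.

Set Implicit Arguments.
Unset Strict Implicit.
Unset Printing Implicit Defensive.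
Import Order.TTheory GRing.Theory Num.Theory.

(** Let [g] be the theta series of the [(-1)^x q^(x^2)], [x] an integer, and
    let [P] be the generating function of overpartitions. By Gauss, [g * P = 1],
    so overpartition pairs are counted by [g^-2]. The congruence comes from
    comparing [g^-2] with [g^6], whose coefficients have a divisor formula.

    Comparison ([pp_six_squares]). Write [g = A + C], where [A] and [C] carry
    the exponents that are 0 and 1 modulo 3 (a square is never 2 modulo 3), and
    [D = A^3 + C^3], a series in [q^3]. Then [g^3 = D + 3ACg], so that modulo 9
    both [D^3 g^-2], which is [g^7] modulo 9, and [g^6] expand into a few
    monomials in [A], [C] and [D]. Their terms with exponent 2 modulo 3 are
    [12 A^2 C^2 D] and [6 A C^2 D]. As [D] is [g^3] modulo 3 and [A] is [g]
    at [q^9], Frobenius gives [D^3 = A] modulo 3, and these parts agree up to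
    the factor 2. Hence [2 * pp n] is congruent modulo 9 to the [n]-th
    coefficient of [g^6] whenever [n] is 2 modulo 3.

    Six squares ([six_squaresE]) and Gauss ([gauss_overpartition]). Both are
    identities between power series, which can be checked on logarithmic
    derivatives: with [theta = q d/dq], they follow from
    [theta g = - 2 g S], [theta P = 2 S P] and
    [g * theta E = 6 E * theta g], where [S] and [E - 1] are
    explicit divisor sums. The coefficients of [g * S] and of [g * theta E]
    are sums over the representations [n = i^2 + d e]; the two identities
    about them are instances of one identity of Liouville ([liouville_identity]), whose
    proof is a bijection followed by two involutions.

    Evaluation ([six_squares_13]). The odd divisors of [2 * 13^k] are the
    powers of 13, all of which are 1 modulo 4, and the coefficient of [g^6] is
    60 times the sum of the [169^j], [j <= k]. As 169 is 1 modulo 3, this is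
    [6 (k + 1)] modulo 9. *)

(** * Formal power series with integer coefficients *)

Local Open Scope ring_scope.

Definition series := nat -> int.
HB.instance Definition _ := gen_eqMixin series.
HB.instance Definition _ := gen_choiceMixin series.

Definition sadd (f g : series) : series := fun n => f n + g n.
Definition sopp (f : series) : series := fun n => - f n.
Definition szero : series := fun _ => 0.
Definition sone : series := fun n => (n == 0%N)%:R.
Definition smul (f g : series) : series :=
  fun n => \sum_(i < n.+1) f i * g (n - i)%N.

Fact saddA : associative sadd.
Proof. by move=> f g h; apply/funext => n; rewrite /sadd addrA. Qed.
Fact saddC : commutative sadd.
Proof. by move=> f g; apply/funext => n; rewrite /sadd addrC. Qed.
Fact sadd0 : left_id szero sadd.
Proof. by move=> f; apply/funext => n; rewrite /sadd add0r. Qed.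
Fact saddN : left_inverse szero sopp sadd.
Proof. by move=> f; apply/funext => n; rewrite /sadd addNr. Qed.
HB.instance Definition _ := GRing.isZmodule.Build series saddA saddC sadd0 saddN.

(** Associativity and commutativity of the Cauchy product are inherited from
    polynomials, because the [n]-th coefficient of a product depends only
    on the coefficients of index at most [n]. *)
Definition trunc N (f : series) : {poly int} := \poly_(i < N) f i.

Fact smul_trunc N f g n : (n < N)%N -> (trunc N f * trunc N g)`_n = smul f g n.
Proof.
move=> nN; rewrite coefM; apply: eq_bigr => i _.
by rewrite !coef_poly !ifT //; have := ltn_ord i; lia.
Qed.

Fact smulC : commutative smul.
Proof.
by move=> f g; apply/funext => n; rewrite -!(@smul_trunc n.+1) // mulrC.
Qed.

Fact smulA : associative smul.
Proof.
move=> f g h; apply/funext => n.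
transitivity (trunc n.+1 f * (trunc n.+1 g * trunc n.+1 h))`_n.
  rewrite coefM; apply: eq_bigr => i _.
  by rewrite coef_poly ltn_ord smul_trunc //; have := ltn_ord i; lia.
rewrite mulrA coefM; apply: eq_bigr => i _.
by rewrite coef_poly smul_trunc // ifT //; have := ltn_ord i; lia.
Qed.

Fact smul1 : left_id sone smul.
Proof.
move=> f; apply/funext => n; rewrite /smul big_ord_recl /= mul1r subn0.
by rewrite big1 ?addr0 // => i _; rewrite mul0r.
Qed.

Fact smulDl : left_distributive smul sadd.
Proof.
move=> f g h; apply/funext => n; rewrite /smul /sadd -big_split /=.
by apply: eq_bigr => i _; rewrite mulrDl.
Qed.

Fact sone_neq0 : sone != 0.
Proof. by apply/eqP => /(congr1 (fun f : series => f 0%N)). Qed.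

HB.instance Definition _ :=
  GRing.Zmodule_isComNzRing.Build series smulA smulC smul1 smulDl sone_neq0.

Lemma saddE (f g : series) n : (f + g) n = f n + g n. Proof. by []. Qed.
Lemma soppE (f : series) n : (- f) n = - f n. Proof. by []. Qed.
Lemma s0E n : (0 : series) n = 0. Proof. by []. Qed.
Lemma s1E n : (1 : series) n = (n == 0%N)%:R. Proof. by []. Qed.
Lemma smulE (f g : series) n :
  (f * g) n = \sum_(i < n.+1) f i * g (n - i)%N.
Proof. by []. Qed.
Lemma snatE (f : series) m n : (m%:R * f) n = m%:R * f n.
Proof.
rewrite !mulr_natl; elim: m => [|m IH]; first by rewrite !mulr0n.
by rewrite !mulrS saddE IH.
Qed.
Lemma ssumE I (r : seq I) (G : I -> series) n :
  (\sum_(i <- r) G i) n = \sum_(i <- r) G i n.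
Proof. by elim: r => [|i r IH]; rewrite ?big_nil // !big_cons saddE IH. Qed.

(** The Euler operator [q d/dq]; unlike [d/dq] it keeps degrees, which makes
    it act on coefficients without a shift. *)
Definition theta (f : series) : series := fun n => n%:Z * f n.

Lemma thetaM f g : theta (f * g) = theta f * g + f * theta g.
Proof.
apply/funext => n; rewrite saddE /theta !smulE big_distrr -big_split /=.
apply: eq_bigr => i _.
have -> : n%:Z = i%:Z + (n - i)%N%:Z by have := ltn_ord i; lia.
ring.
Qed.
Lemma thetaD f g : theta (f + g) = theta f + theta g.
Proof. by apply/funext => n; rewrite saddE /theta saddE mulrDr. Qed.

(** Multiplication by [u] is unitriangular on coefficients. The case [m = 0]
    is the cancellation law [series_mulI]. *)
Lemma dvdz_cancel (m : int) (u f : series) : u 0%N = 1 ->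
  (forall n, m %| (u * f) n)%Z -> forall n, (m %| f n)%Z.
Proof.
move=> u0 h; elim/ltn_ind => n IH.
have := h n; rewrite smulE big_ord_recl /= u0 mul1r subn0 rpredDr //.
apply: rpred_sum => i _; apply: dvdz_mull; apply: IH.
by rewrite /bump /=; have := ltn_ord i; lia.
Qed.

Lemma series_mulI (u f g : series) : u 0%N = 1 -> u * f = u * g -> f = g.
Proof.
move=> u0 e; apply/funext => n; apply/eqP; rewrite -subr_eq0 -dvd0z.
apply: (@dvdz_cancel 0 u (f - g)) => // k.
by rewrite mulrBr e subrr.
Qed.

(** * Counting and generating functions *)

(** The value is an integer rather than a natural number, so that it can be
    compared with coefficients of series. Finiteness is witnessed by a list
    because the objects counted form an infinite type. *)
Definition counts (T : eqType) (P : pred T) (z : int) : Prop :=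
  exists s : seq T, [/\ uniq s, s =i P & z = (size s)%:Z].

Lemma eq_counts (T : eqType) (P Q : pred T) z :
  P =1 Q -> counts P z -> counts Q z.
Proof. by move=> e [s [us ms ->]]; exists s; split=> // x; rewrite ms; apply: e. Qed.

Lemma counts_unique (T : eqType) (P : pred T) y z :
  counts P y -> counts P z -> y = z.
Proof.
move=> [s [us ms ->]] [t [ut mt ->]]; congr Posz.
by apply/perm_size/uniq_perm => // x; rewrite ms mt.
Qed.

Lemma counts0 (T : eqType) (P : pred T) : P =1 pred0 -> counts P 0.
Proof. by move=> e; exists [::]; split=> // x; rewrite [RHS]e. Qed.

Lemma countsU (T : eqType) (P Q : pred T) y z :
  (forall x, P x -> ~~ Q x) -> counts P y -> counts Q z ->
  counts (predU P Q) (y + z).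
Proof.
move=> dis [s [us ms ->]] [t [ut mt ->]]; exists (s ++ t); split.
- rewrite cat_uniq us ut andbT; apply/hasPn => x; rewrite mt => Qx.
  by rewrite ms; apply/negP => /dis/negP; apply.
- by move=> x; rewrite mem_cat ms mt.
- by rewrite size_cat PoszD.
Qed.

Lemma counts_image (T U : eqType) (f : T -> U) (P : pred T) (Q : pred U) z :
  injective f -> (forall y, reflect (exists2 x, y = f x & P x) (Q y)) ->
  counts P z -> counts Q z.
Proof.
move=> fI fP [s [us ms ->]]; exists (map f s); split.
- by rewrite map_inj_uniq.
- move=> y; apply/mapP/fP => -[x].
    by rewrite ms => Px ->; exists x.
  by move=> -> Px; exists x; rewrite ?ms.
- by rewrite size_map.
Qed.

Lemma counts_prod (T U : eqType) (P : pred T) (Q : pred U) y z :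
  counts P y -> counts Q z -> counts [pred x | P x.1 && Q x.2] (y * z).
Proof.
move=> [s [us ms ->]] [t [ut mt ->]]; exists [seq (x, y) | x <- s, y <- t].
split; last by rewrite size_allpairs PoszM.
- by apply: allpairs_uniq => // -[a b] [c d] _ _ [-> ->].
- move=> [a b]; apply/allpairsP/andP => /= [[[c d] [/=]]|[Pa Qb]].
    by rewrite ms mt => Pc Qd [-> ->].
  by exists (a, b); rewrite ms mt.
Qed.

Lemma counts_bigU (T : eqType) (P : nat -> pred T) (z : nat -> int) m :
  (forall i j x, P i x -> P j x -> i = j) -> (forall i, counts (P i) (z i)) ->
  counts [pred x | has (P^~ x) (iota 0 m)] (\sum_(i < m) z i).
Proof.
move=> dis cP; elim: m => [|m IH]; first by rewrite big_ord0; apply: counts0.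
rewrite big_ord_recr; apply: eq_counts (countsU _ IH (cP m)).
  by move=> x; rewrite !inE -[in RHS]addn1 iotaD has_cat /= orbF.
move=> x /= /hasP[i]; rewrite mem_iota /= add0n => im Pi; apply/negP => Pm.
by move: im; rewrite (dis _ _ _ Pi Pm) ltnn.
Qed.

Definition has_gf (T : eqType) (w : T -> nat) (P : pred T) (G : series) :=
  forall n, counts [pred x | P x && (w x == n)] (G n).

Lemma has_gf_prod (T U : eqType) (w : T -> nat) (v : U -> nat)
    (P : pred T) (Q : pred U) G H :
  has_gf w P G -> has_gf v Q H ->
  has_gf (fun x => w x.1 + v x.2)%N [pred x | P x.1 && Q x.2] (G * H).
Proof.
move=> gG gH n; rewrite smulE.
pose R i := [pred x | [&& P x.1, Q x.2, w x.1 == i & (w x.1 + v x.2 == n)%N]].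
pose c i : int := if (i <= n)%N then G i * H (n - i)%N else 0.
rewrite (eq_bigr (fun i : 'I_n.+1 => c i)); last first.
  by move=> i _; rewrite /c -ltnS ltn_ord.
apply: (@eq_counts _ [pred x | has (R^~ x) (iota 0 n.+1)]).
  move=> [x y]; apply/hasP/idP.
    by case=> i _ /and4P[/= -> -> _ ->].
  case/andP=> /andP[/= Px Qy] e.
  exists (w x); last by rewrite /= Px Qy e eqxx.
  by have := mem_iota 0 n.+1 (w x) => ->; lia.
apply: counts_bigU => [i j x /and4P[_ _ /eqP <- _] /and4P[_ _ /eqP <- _] // | i].
rewrite /c; case: leqP => ni.
  apply: eq_counts (counts_prod (gG i) (gH (n - i)%N)) => -[x y] /=.
  by case: (P x); case: (Q y) => //=; apply/idP/idP; lia.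
by apply: counts0 => -[x y] /=; apply/negP; lia.
Qed.

(** Peeling off the largest part: an equal part further on must not be
    overlined, and this is the only condition that ties the overlining of [x]
    to the tail. *)
Lemma is_overpartition_cons x s :
  is_overpartition (x :: s) =
  [&& 0 < x.1, all (fun y => y.1 <= x.1) s, (x.1, true) \notin s
    & is_overpartition s]%N.
Proof.
rewrite /is_overpartition /= (iotaDl 1 0) all_map /=.
rewrite implybT /= path_sortedE; last by move=> a b c /= h1 h2; apply: leq_trans h2 h1.
set o := all _ (iota 0 _); set o' := all _ (iota 0 _).
have -> : o = ((x.1, true) \notin s) && o'.
  apply/allP/andP => [h|[xs /allP h] i].
    split; last first.
      by apply/allP => i /h /=; case: (nth _ _ _) => //=; rewrite inE; case/norP.
    apply/negP => /(nthP (0%N, false))[i si e].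
    have := h i; rewrite mem_iota si /= (nth_map (0%N, false)) // e /=.
    by rewrite (nth_map (0%N, false)) // e inE eqxx /= => /(_ isT).
  move=> ii; have := h i ii; rewrite /= inE.
  case: (boolP (nth _ _ _)) => //= b /negbTE ->; rewrite orbF.
  move: ii; rewrite mem_iota /= add0n => si.
  apply: contra xs => /eqP e; apply/(nthP (0%N, false)); exists i => //.
  move: b e; rewrite !(nth_map (0%N, false)) //.
  by case: (nth _ s i) => u v /= -> ->.
rewrite /parts /unzip1 !all_map.
by case: (0 < x.1)%N; case: (all _ s); case: (_ \notin s); case: (sorted _ _);
  rewrite //= ?andbF.
Qed.

Definition monom (a : nat) : series := fun n => (n == a)%:R.
(** The geometric series [1 / (1 - q^a)]. *)
Definition geom (a : nat) : series := fun n => (a %| n)%N%:R.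

Lemma monomM a f n : (monom a * f) n = if (a <= n)%N then f (n - a)%N else 0.
Proof.
rewrite smulE; case: leqP => an.
  rewrite (bigD1 (Ordinal (an : a < n.+1)%N)) //= /monom eqxx mul1r big1 ?addr0 //.
  move=> i; rewrite -val_eqE /= => /negbTE ->; exact: mul0r.
apply: big1 => i _; rewrite /monom.
have -> : (i == a :> nat) = false by have := ltn_ord i; lia.
exact: mul0r.
Qed.

Lemma geomE a : (0 < a)%N -> geom a = 1 + monom a * geom a.
Proof.
move=> a0; apply/funext => n; rewrite saddE monomM s1E /geom.
case: leqP => an.
  by rewrite -{1}(subnK an) dvdn_addl // (gtn_eqF (leq_trans a0 an)) add0r.
case: posnP => [->|n0]; first by rewrite dvdn0 addr0.
by rewrite addr0 gtnNdvd.
Qed.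

Definition overpartition_le m (s : seq (nat * bool)) :=
  is_overpartition s && all (fun y => y.1 <= m)%N s.
(** What can follow a part of size [m] in an overpartition with parts at most
    [m]. *)
Definition overpartition_le_plain_max m (s : seq (nat * bool)) :=
  overpartition_le m s && ((m, true) \notin s).

Lemma overpartition_leS m s :
  overpartition_le m.+1 s =
  overpartition_le m s ||
  (if s is (a, _) :: s' then (a == m.+1) && overpartition_le_plain_max m.+1 s'
   else false).
Proof.
case: s => [|[a o] s] //=.
rewrite /overpartition_le_plain_max /overpartition_le !is_overpartition_cons /=.
case: (ltngtP a m.+1) => [am|am|->] /=; rewrite ?orbF.
- have -> : (a <= m)%N by lia.
  case: (boolP (all (fun y => y.1 <= a)%N s)); rewrite ?andbF //= => /allP sa.
  have le_s k : (a <= k)%N -> all (fun y : nat * bool => y.1 <= k)%N s.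
    by move=> ak; apply/allP => y /sa /leq_trans; apply.
  by rewrite !le_s //; lia.
- by have -> : (a <= m)%N = false by apply/negbTE; lia.
- rewrite ltnn /= andbF /=.
  by case: (all _ s); case: (_ \notin s); case: (is_overpartition s).
Qed.

Lemma overpartition_le_plain_maxS m s :
  overpartition_le_plain_max m.+1 s =
  overpartition_le m s ||
  (if s is (a, o) :: s' then
     [&& a == m.+1, ~~ o & overpartition_le_plain_max m.+1 s'] else false).
Proof.
rewrite {1}/overpartition_le_plain_max overpartition_leS andb_orl; congr (_ || _).
  apply: andb_idr => /andP[_ /allP h]; apply/negP => /h /=; by rewrite ltnn.
case: s => [|[a o] s] //=; rewrite inE xpair_eqE negb_or [m.+1 == a]eq_sym.
rewrite /overpartition_le_plain_max; case: (a == _) => //=.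
by case: o => /=; case: (_ \notin s); rewrite ?andbF ?andbT.
Qed.

Lemma counts_cons m o n z (Q : pred (seq (nat * bool))) :
  counts [pred s | Q s && (weight s == n - m)%N] z -> (m <= n)%N ->
  counts [pred s : seq (nat * bool) |
    (if s is x :: s' then (x == (m, o)) && Q s' else false) && (weight s == n)] z.
Proof.
move=> cQ mn; apply: (@counts_image _ _ (cons (m, o))) cQ => [s t []//|].
case=> [|x s] /=; first by apply: ReflectF => -[].
apply: (iffP andP) => [[/andP[/eqP-> Qs] e]|[t [-> ->]]] /=.
  exists s => //; rewrite Qs; move: e; rewrite /weight /=; lia.
by case/andP=> -> e; rewrite eqxx; split=> //; move: e; rewrite /weight /=; lia.
Qed.

Lemma counts_cons0 m o n (Q : pred (seq (nat * bool))) : (n < m)%N ->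
  counts [pred s : seq (nat * bool) |
    (if s is x :: s' then (x == (m, o)) && Q s' else false) && (weight s == n)] 0.
Proof.
move=> nm; apply: counts0 => -[|x s] //=; apply/negP.
case/andP=> /andP[/eqP -> _]; rewrite /weight /=; lia.
Qed.

Lemma has_gf_cons m o G Q : has_gf weight Q G ->
  has_gf weight (fun s => if s is x :: s' then (x == (m, o)) && Q s' else false)
    (monom m * G).
Proof.
move=> gQ n; rewrite monomM; case: leqP => mn; last exact: counts_cons0.
exact: counts_cons (gQ _) mn.
Qed.

Lemma has_gfU (T : eqType) (w : T -> nat) (P Q : pred T) G H :
  (forall x, P x -> ~~ Q x) -> has_gf w P G -> has_gf w Q H ->
  has_gf w (predU P Q) (G + H).
Proof.
move=> dis gG gH n; apply: eq_counts (countsU _ (gG n) (gH n)).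
  by move=> x /=; rewrite andb_orl.
by move=> x /andP[Px _]; rewrite /= negb_and (dis x).
Qed.

Lemma eq_has_gf (T : eqType) (w : T -> nat) (P Q : pred T) G :
  P =1 Q -> has_gf w P G -> has_gf w Q G.
Proof. by move=> e gP n; apply: eq_counts (gP n) => x /=; rewrite e. Qed.

(** The product of the [(1 + q^j) / (1 - q^j)], [1 <= j <= m], each factor
    written as [1 + 2 q^j / (1 - q^j)]: the last summand says that the first
    part [j] may or may not be overlined and that plain parts [j] follow. *)
Fixpoint overpartition_le_gf m : series :=
  if m is m'.+1
  then overpartition_le_gf m' + 2%:R * (monom m * (overpartition_le_gf m' * geom m))
  else 1.

Lemma has_gf_le_plain_max m G : has_gf weight (overpartition_le m) G ->
  has_gf weight (overpartition_le_plain_max m.+1) (G * geom m.+1).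
Proof.
move=> gG; elim/ltn_ind => n IH.
have e : G * geom m.+1 = G + monom m.+1 * (G * geom m.+1).
  by rewrite {1}geomE //; ring.
rewrite e saddE monomM.
pose Q := (fun s : seq (nat * bool) => if s is x :: s' then
  (x == (m.+1, false)) && overpartition_le_plain_max m.+1 s' else false).
apply: (@eq_counts _ (predU [pred s | overpartition_le m s && (weight s == n)]
   [pred s | Q s && (weight s == n)])).
  move=> s; rewrite /= -andb_orl overpartition_le_plain_maxS; congr ((_ || _) && _).
  by case: s => // -[a o] s; rewrite /= xpair_eqE; case: o; rewrite /= ?andbF ?andbT.
apply: countsU (gG n) _.
  case=> [|x s] //= /andP[/andP[_ /= /andP[xm _]] _].
  apply/negP => /andP[/andP[/eqP xe _] _].
  by rewrite xe /= ltnn in xm.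
case: leqP => mn.
  exact: (@counts_cons0 m.+1 false n (overpartition_le_plain_max m.+1)).
have nm : (n - m.+1 < n)%N by lia.
exact: (@counts_cons m.+1 false n _ (overpartition_le_plain_max m.+1) (IH _ nm) mn).
Qed.

Lemma has_gf_overpartition_le m :
  has_gf weight (overpartition_le m) (overpartition_le_gf m).
Proof.
elim: m => [|m IH] /=.
  move=> n; rewrite s1E.
  have e s : overpartition_le 0 s = (s == [::]).
    case: s => // -[a o] s; rewrite /overpartition_le is_overpartition_cons /=.
    by case: a => //= a; rewrite ?andbF.
  case: eqP => n0; last first.
    by apply: counts0 => s /=; rewrite e; case: eqP => // ->; case: eqP => // h; case: n0.
  exists [:: [::]]; split=> // s; rewrite inE [RHS]inE e n0.
  by case: eqP => // ->.
have gc o := has_gf_cons m.+1 o (has_gf_le_plain_max IH).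
rewrite mulr_natl mulr2n.
refine (eq_has_gf _ (has_gfU _ IH (has_gfU _ (gc true) (gc false)))).
- move=> s; rewrite overpartition_leS /=; congr (_ || _).
  case: s => // -[a o] s; rewrite !xpair_eqE.
  by case: o; case: (a == _); rewrite //= ?orbF.
- move=> [|[a o] s] // /andP[_ /= /andP[am _]] /=; rewrite !xpair_eqE.
  have -> : (a == m.+1) = false by apply/negbTE; lia.
  by [].
- by case=> [|x s] //= /andP[/eqP -> _]; rewrite xpair_eqE andbF.
Qed.

Definition overpartition_gf : series := fun n => overpartition_le_gf n n.

Lemma all_le_weight s :
  all (fun y => y.1 <= weight s)%N s.
Proof.
apply/allP => x; rewrite /weight.
elim: s => //= y s IH; rewrite inE => /predU1P[->|/IH h]; first exact: leq_addr.
exact: leq_trans h (leq_addl _ _).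
Qed.

(** Parts of an overpartition of [n] do not exceed [n], so that the infinite
    product can be read off its finite sections. *)
Lemma overpartition_le_gf_stable m n : (n <= m)%N ->
  overpartition_le_gf m n = overpartition_gf n.
Proof.
move=> nm; apply: counts_unique (has_gf_overpartition_le m n) _.
apply: eq_counts (has_gf_overpartition_le n n) => s /=; rewrite /overpartition_le.
case: eqP => e; rewrite ?andbF // !andbT.
congr (_ && _); rewrite -e all_le_weight.
by apply/esym; apply: sub_all (all_le_weight s) => x /leq_trans; apply; rewrite e.
Qed.

Lemma has_gf_overpartition : has_gf weight is_overpartition overpartition_gf.
Proof.
move=> n; apply: eq_counts (has_gf_overpartition_le n n) => s /=; rewrite /overpartition_le.
case: eqP => e; rewrite ?andbF // !andbT.
by rewrite -e all_le_weight andbT.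
Qed.

Lemma pp_gf n : (pp n)%:Z = (overpartition_gf ^+ 2) n.
Proof.
have [s [us ms <-]] := ppP n.
apply: (@counts_unique _ (is_overpartition_pair n)); first by exists s.
rewrite expr2; apply: eq_counts (has_gf_prod has_gf_overpartition has_gf_overpartition n).
by move=> p; rewrite /is_overpartition_pair /= andbA.
Qed.

(** * The logarithmic derivative of the overpartition series *)

Definition dpairs (n : nat) : seq (nat * nat) :=
  [seq ((n %/ e)%N, e) | e <- iota 1 n & (e %| n)%N].

Lemma mem_dpairs n d e : ((d, e) \in dpairs n) = (0 < n)%N && (d * e == n)%N.
Proof.
apply/mapP/andP => [[x + [-> ->]]|[n0 /eqP den]].
  rewrite mem_filter mem_iota => /andP[xn /andP[x0 xn']].
  by rewrite divnK // eqxx; split=> //; lia.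
have e0 : (0 < e)%N by case: e den => //; lia.
have d0 : (0 < d)%N by case: d den => //; lia.
exists e; last by rewrite -den mulnK.
by rewrite mem_filter mem_iota -den dvdn_mull //=; nia.
Qed.

Lemma dpairs_uniq n : uniq (dpairs n).
Proof.
rewrite map_inj_uniq; first exact/filter_uniq/iota_uniq.
by move=> x y [].
Qed.

Lemma dpairs_swap n (h : nat -> nat -> int) :
  \sum_(p <- dpairs n) h p.1 p.2 = \sum_(p <- dpairs n) h p.2 p.1.
Proof.
have swapI : injective (fun p : nat * nat => (p.2, p.1)) by move=> [a b] [c d] [-> ->].
have e : perm_eq [seq (p.2, p.1) | p <- dpairs n] (dpairs n).
  apply: uniq_perm; [by rewrite (map_inj_uniq swapI) dpairs_uniq | exact: dpairs_uniq |].
  move=> [d e]; have := @mem_map _ _ _ swapI (dpairs n) (e, d) => /= ->.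
  by rewrite !mem_dpairs mulnC.
by rewrite -(perm_big _ e) big_map.
Qed.

(** The series [a q^a / (1 - q^(2a))], which is half the logarithmic
    derivative of [(1 + q^a) / (1 - q^a)]. *)
Definition lambert (a : nat) : series :=
  fun n => if (a %| n)%N && odd (n %/ a) then a%:R else 0.

Lemma lambertE a : (0 < a)%N ->
  (1 - monom a ^+ 2) * lambert a = a%:R * monom a.
Proof.
move=> a0; apply/funext => n.
have -> : (1 - monom a ^+ 2) * lambert a =
   lambert a - monom a * (monom a * lambert a) by ring.
rewrite saddE soppE snatE !monomM /lambert /monom.
case: (boolP (a %| n)%N) => [/dvdnP[c ->]|an].
  rewrite mulnK //; case: c => [|[|c]] /=.
  - by rewrite mul0n leqn0 (gtn_eqF a0) (ltn_eqF a0) subr0 mulr0.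
  - by rewrite mul1n leqnn subnn leqNgt a0 /= eqxx mulr1 subr0.
  - rewrite !mulSn leq_addr addKn leq_addr addKn dvdn_mull // mulnK //=.
    by rewrite negbK subrr -[X in (_ == X)]addn0 eqn_add2l addn_eq0 (gtn_eqF a0) mulr0.
rewrite /= sub0r; have -> : (n == a) = false.
  by apply/negbTE; apply: contra an => /eqP ->.
rewrite mulr0; apply/eqP; rewrite oppr_eq0.
case: leqP => // an1; case: leqP => // an2.
by rewrite !dvdn_subl // (negbTE an).
Qed.

Definition odd_codivisor_sum : series :=
  fun n => \sum_(p <- dpairs n) if odd p.2 then p.1%:Z else 0.

Lemma lambert_sumE m n : (n <= m)%N ->
  (\sum_(i < m) lambert i.+1) n = odd_codivisor_sum n.
Proof.
move=> nm; rewrite ssumE /odd_codivisor_sum.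
rewrite (@dpairs_swap n (fun d e => if odd e then d%:Z else 0)).
rewrite big_map /= big_filter.
rewrite -(big_mkord xpredT (fun i => lambert i.+1 n)).
rewrite -(big_add1 _ _ 0 m.+1 xpredT (fun i => lambert i n)).
rewrite (@big_cat_nat _ _ _ n.+1) //= [X in _ + X]big1_seq ?addr0; last first.
  move=> i; rewrite mem_index_iota /lambert => /andP[_ /andP[ni _]].
  case: (posnP n) => [->|n0]; first by rewrite div0n andbF.
  by rewrite gtnNdvd.
rewrite /index_iota subn1 /= [RHS]big_mkcond; apply: eq_bigr => i _.
by rewrite /lambert natz; case: (_ %| _)%N.
Qed.

Lemma theta_monom a : theta (monom a) = a%:R * monom a.
Proof.
apply/funext => n; rewrite snatE /theta /monom -[n%:Z]natz.
by case: eqP => [->|_] //=; rewrite !mulr0.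
Qed.

Lemma theta1 : theta 1 = 0.
Proof. by apply/funext => -[|n]; rewrite /theta ?mul0r // s1E mulr0. Qed.

(** Logarithmic derivative of a finite product, by induction on the number of
    factors; the recursion [(1 - q^a) P = (1 + q^a) Q] is differentiated instead
    of a quotient, and [1 - q^(2a)] is cancelled at the end. *)
Lemma theta_overpartition_le_gf m :
  theta (overpartition_le_gf m) =
  2%:R * (\sum_(i < m) lambert i.+1) * overpartition_le_gf m.
Proof.
elim: m => [|m IH]; first by rewrite /= theta1 big_ord0 mulr0 mul0r.
rewrite big_ord_recr /= -/(overpartition_le_gf m.+1).
set P := overpartition_le_gf m.+1; set Q := overpartition_le_gf m in IH *.
set X := monom m.+1; set L := lambert _; set S := \sum_(i < m) _ in IH *.
have hP : (1 - X) * P = (1 + X) * Q.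
  rewrite /P /= -/X -/Q; have := geomE (ltn0Sn m); rewrite -/X => gE.
  transitivity ((1 - X) * Q + 2%:R * X * Q * (geom m.+1 - X * geom m.+1));
    first by ring.
  by rewrite {1}gE; ring.
have hL : (1 - X ^+ 2) * L = m.+1%:R * X := lambertE (ltn0Sn m).
have tX : theta X = m.+1%:R * X := theta_monom m.+1.
have theta1X : theta (1 + X) = theta X by rewrite thetaD theta1 add0r.
have theta1NX : theta (1 - X) = - theta X.
  apply/eqP; rewrite -subr_eq0 opprK -thetaD.
  by rewrite subrK theta1.
have := congr1 theta hP; rewrite !thetaM theta1X theta1NX tX IH => hd.
apply: (@series_mulI (1 - X ^+ 2)).
  by rewrite saddE soppE expr2 monomM /= subr0.
set a := m.+1%:R in hL hd *; set tP := theta P in hd *.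
have -> : (1 - X ^+ 2) * (2%:R * (S + L) * P) =
  2%:R * S * P * (1 - X ^+ 2) + 2%:R * P * ((1 - X ^+ 2) * L) by ring.
rewrite hL.
transitivity ((1 + X) * (- (a * X) * P + (1 - X) * tP) + (1 + X) * a * X * P);
  first by ring.
rewrite hd.
transitivity (((1 + X) * Q) * ((a * X) + (1 + X) * 2%:R * S) + (1 + X) * a * X * P);
  first by ring.
rewrite -hP; ring.
Qed.

Lemma theta_overpartition_gf :
  theta overpartition_gf = 2%:R * odd_codivisor_sum * overpartition_gf.
Proof.
apply/funext => n; rewrite -mulrA snatE.
transitivity (theta (overpartition_le_gf n) n); first by [].
rewrite theta_overpartition_le_gf -mulrA snatE; congr (_ * _).
rewrite !smulE; apply: eq_bigr => i _; rewrite lambert_sumE ?overpartition_le_gf_stable //.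
  exact: leq_subr.
by rewrite -ltnS.
Qed.

(** * Representations of an integer as a square plus a product *)

Definition oddz (x : int) : bool := (x %% 2)%Z == 1.
(** The sign [(-1)^x] for an integer [x]. *)
Definition parity_sign (x : int) : int := if oddz x then -1 else 1.
(** The non-principal Dirichlet character modulo 4. *)
Definition chi4 (x : int) : int :=
  if (x %% 4)%Z == 1 then 1 else if (x %% 4)%Z == 3 then -1 else 0.

Lemma oddz_nat (n : nat) : oddz n = odd n.
Proof. rewrite /oddz. lia. Qed.
Lemma oddzN x : oddz (- x) = oddz x. Proof. rewrite /oddz. lia. Qed.
Lemma oddzD x y : oddz (x + y) = oddz x (+) oddz y.
Proof. rewrite /oddz. case: eqP; case: eqP; case: eqP; lia. Qed.
Lemma parity_signN x : parity_sign (- x) = parity_sign x.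
Proof. by rewrite /parity_sign oddzN. Qed.
Lemma parity_signD x y : parity_sign (x + y) = parity_sign x * parity_sign y.
Proof. by rewrite /parity_sign oddzD; case: (oddz x); case: (oddz y). Qed.
Lemma chi4N x : chi4 (- x) = - chi4 x.
Proof. rewrite /chi4; do !case: eqP; lia. Qed.
Lemma chi4_reflect m x : chi4 (2 * m - x) * parity_sign m = - chi4 x.
Proof. rewrite /chi4 /parity_sign /oddz; do !case: eqP; lia. Qed.

Definition ints (n : nat) : seq int :=
  [seq i%:Z - n%:Z | i <- iota 0 (n + n).+1].

Lemma mem_ints n x : (x \in ints n) = (`|x|%N <= n)%N.
Proof.
apply/mapP/idP => [[i]|xn]; first by rewrite mem_iota => /andP[_ ?] ->; lia.
exists (absz (x + n%:Z)); last by lia.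
by rewrite mem_iota; lia.
Qed.
Lemma ints_uniq n : uniq (ints n).
Proof. by rewrite map_inj_uniq ?iota_uniq // => i j; lia. Qed.

Definition sqrts (n : nat) : seq int := [seq x <- ints n | x ^+ 2 == n%:Z].
Lemma mem_sqrts n x : (x \in sqrts n) = (x ^+ 2 == n%:Z).
Proof.
rewrite mem_filter mem_ints; apply: andb_idr => /eqP; rewrite expr2; nia.
Qed.
Lemma sqrts_uniq n : uniq (sqrts n).
Proof. exact/filter_uniq/ints_uniq. Qed.

(** The triples [(x, d, e)] with [d, e > 0] and [n = x^2 + d * e], listed by
    [x] so that sums over them factor as Cauchy products. *)
Definition reps (n : nat) : seq (int * int * int) :=
  [seq (x, p.1%:Z, p.2%:Z) | x <- [seq x <- ints n | x ^+ 2 <= n%:Z],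
                             p <- dpairs (n - `|x| ^ 2)%N].

Lemma mem_reps n x d e :
  ((x, d, e) \in reps n) = [&& 0 < d, 0 < e & x ^+ 2 + d * e == n%:Z].
Proof.
apply/allpairsPdep/and3P => [[y [[a b] [hy hp [-> -> ->]]]]|[d0 e0 /eqP h]].
  move: hy hp; rewrite mem_filter mem_dpairs => /andP[hy _] /andP[n0 /eqP ab].
  split; [nia | nia |]; apply/eqP.
  have : (y ^+ 2 = `|y|%N%:Z ^+ 2) by rewrite !expr2; nia.
  rewrite !expr2 -mulnn in n0 hy ab *; nia.
exists x, (absz d, absz e); split.
- rewrite mem_filter mem_ints; apply/andP; rewrite !expr2 in h *; split; nia.
- rewrite mem_dpairs -mulnn; apply/andP; rewrite !expr2 in h; split; nia.
- by congr (_, _, _) => /=; lia.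
Qed.

Lemma reps_uniq n : uniq (reps n).
Proof.
apply: allpairs_uniq_dep => [|x _|].
- exact/filter_uniq/ints_uniq.
- exact: dpairs_uniq.
by case=> x [a b] [y [c d]] _ _ /= [-> -> ->].
Qed.

(** Every cancellation below compares a sum with its image under an involution
    of the index set. *)
Lemma sum_involution (T : eqType) (s : seq T) (f : T -> T) (G : T -> int) :
  uniq s -> {in s, forall t, f t \in s} -> {in s, forall t, f (f t) = t} ->
  \sum_(t <- s) G t = \sum_(t <- s) G (f t).
Proof.
move=> us fs fK.
have fI : {in s &, injective f} by move=> x y /fK {2}<- /fK {2}<- ->.
rewrite -[RHS](big_map f xpredT); apply: perm_big; apply: uniq_perm => //.
  by rewrite map_inj_in_uniq.
move=> x; apply/idP/mapP => [xs|[y ys ->]]; last exact: fs.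
by exists (f x); rewrite ?fs ?fK.
Qed.

Definition triple_fun (G : int -> int -> int -> int) (t : int * int * int) : int :=
  G t.1.1 t.1.2 t.2.

Definition rep_sum n G := \sum_(t <- reps n) triple_fun G t.

Lemma rep_sum_swap n G : rep_sum n G = rep_sum n (fun x d e => G x e d).
Proof.
rewrite /rep_sum (@sum_involution _ _ (fun t => (t.1.1, t.2, t.1.2))) //.
- exact: reps_uniq.
- by move=> [[x d] e]; rewrite !mem_reps /= mulrC andbCA.
- by move=> [[x d] e].
Qed.

Lemma rep_sum_opp n G : rep_sum n G = rep_sum n (fun x d e => G (- x) d e).
Proof.
rewrite /rep_sum (@sum_involution _ _ (fun t => (- t.1.1, t.1.2, t.2))) //.
- exact: reps_uniq.
- by move=> [[x d] e]; rewrite !mem_reps /= sqrrN.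
- by move=> [[x d] e] _ /=; rewrite opprK.
Qed.

Lemma rep_sumD n G H :
  rep_sum n (fun x d e => G x d e + H x d e) = rep_sum n G + rep_sum n H.
Proof. by rewrite /rep_sum -big_split. Qed.

Lemma rep_sumZ n (c : int) G :
  rep_sum n (fun x d e => c * G x d e) = c * rep_sum n G.
Proof. by rewrite /rep_sum big_distrr. Qed.

(** Exchanging [d] and [e] and negating [x] preserve the representations, so
    a sum vanishes as soon as its average over this group of order 4 does. This
    reduces the applications of Liouville's identity to pointwise algebra. *)
Lemma rep_sum_symm0 n G :
  (forall x d e, G x d e + G (- x) d e + G x e d + G (- x) e d = 0) ->
  rep_sum n G = 0.
Proof.
move=> h.
have : rep_sum n G + rep_sum n (fun x d e => G (- x) d e) +
  rep_sum n (fun x d e => G x e d) + rep_sum n (fun x d e => G (- x) e d) = 0.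
  by rewrite -!rep_sumD /rep_sum big1 // => t _; rewrite /triple_fun h.
have e1 := rep_sum_opp n G; have e2 := rep_sum_swap n G.
have e3 := rep_sum_swap n (fun x d e => G (- x) d e).
rewrite -e2 -e3 -e1; lia.
Qed.

Lemma big_split3 (T : eqType) (s : seq T) (w : T -> int) (G : T -> int) :
  \sum_(t <- s) G t = \sum_(t <- s | w t < 0) G t +
    (\sum_(t <- s | w t == 0) G t + \sum_(t <- s | 0 < w t) G t).
Proof.
rewrite (bigID (fun t => w t < 0)) /=; congr (_ + _).
rewrite (bigID (fun t => w t == 0)) /=; congr (_ + _); apply: eq_bigl => t; lia.
Qed.

(** * An identity of Liouville *)

Section Liouville.
Variables (n : nat) (F : int -> int -> int -> int).
Hypothesis F_odd : forall x y z, F (- x) y z = - F x y z.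
Hypothesis F_even : forall x y z, F x (- y) (- z) = F x y z.
Hypothesis F_double : forall x y z, F (2 * x) y (2 * z) = 0.

Let K := triple_fun (fun y d e => F (d + e) y (d - e)).
Let w (t : int * int * int) : int := t.2 - t.1.2 + 2 * t.1.1.
(** The change of variables [(i, d, e) -> (d + i, d, e - 2 i - d)] keeps the
    form [i^2 + d e], but the last entry of its image may be negative or zero. *)
Let U : seq (int * int * int) :=
  [seq (t.1.2 + t.1.1, t.1.2, t.2 - 2 * t.1.1 - t.1.2) | t <- reps n].

Let U_uniq : uniq U.
Proof.
rewrite map_inj_uniq ?reps_uniq // => -[[x d] e] [[x' d'] e'] /= [h1 h2 h3].
congr (_, _, _); lia.
Qed.

Let mem_U y d e :
  ((y, d, e) \in U) = [&& 0 < d, 0 < e - d + 2 * y & y ^+ 2 + d * e == n%:Z].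
Proof.
apply/mapP/and3P => [[[[x d'] e']]|[d0 w0 /eqP h]].
  rewrite mem_reps /= => /and3P[d0 e0 /eqP h] [-> -> ->].
  split=> //; first by lia.
  by rewrite -h; apply/eqP; ring.
exists (y - d, d, e - d + 2 * y); last by congr (_, _, _) => /=; lia.
rewrite mem_reps d0 w0 /= -h; apply/eqP; ring.
Qed.

(** On the part with last entry negative, [(y, d, e) -> (y, - e, - d)] is an
    involution that changes the sign of [d + e]. *)
Let sum_U_neg : \sum_(t <- U | t.2 < 0) K t = 0.
Proof.
rewrite -big_filter.
set S := \sum_(t <- _) _; suff : S = - S by lia.
rewrite {1}/S (@sum_involution _ _ (fun t => (t.1.1, - t.2, - t.1.2))) /=.
- rewrite /S -sumrN; apply: eq_bigr => -[[y d] e] _.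
  by rewrite /K /triple_fun /= -F_odd; congr (F _ _ _); ring.
- exact: filter_uniq.
- move=> [[y d] e]; rewrite !mem_filter !mem_U /= => /and4P[e0 d0 w0 /eqP h].
  by apply/and4P; split; [lia | lia | lia | rewrite -h; apply/eqP; ring].
- by move=> [[y d] e] _ /=; rewrite !opprK.
Qed.

Let sum_U_pos : \sum_(t <- U | 0 < t.2) K t = \sum_(t <- reps n | 0 < w t) K t.
Proof.
rewrite -big_filter -[RHS]big_filter; apply: perm_big; apply: uniq_perm.
- exact: filter_uniq.
- exact/filter_uniq/reps_uniq.
- by move=> [[y d] e]; rewrite !mem_filter mem_U mem_reps /w /=; do !bool_congr.
Qed.

(** The involution [(y, d, e) -> (- y, e, d)] changes the sign of [w], so the
    terms with [w > 0] make up half of the sum over [reps n]. *)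
Let sum_reps_neg :
  \sum_(t <- reps n | w t < 0) K t = \sum_(t <- reps n | 0 < w t) K t.
Proof.
rewrite [LHS]big_mkcond [RHS]big_mkcond /=.
rewrite (@sum_involution _ _ (fun t => (- t.1.1, t.2, t.1.2))).
- apply: eq_bigr => -[[y d] e] _; rewrite /w /=.
  have -> : (d - e + 2 * - y < 0) = (0 < e - d + 2 * y) by lia.
  by case: ifP => // _; rewrite /K /triple_fun /= -F_even; congr (F _ _ _); ring.
- exact: reps_uniq.
- by move=> [[x d] e]; rewrite !mem_reps /= sqrrN mulrC andbCA.
- by move=> [[x d] e] _ /=; rewrite opprK.
Qed.

Let sum_reps0 : \sum_(t <- reps n | w t == 0) K t = 0.
Proof.
apply: big1 => -[[y d] e]; rewrite /w /K /triple_fun /= => /eqP h.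
have -> : d + e = 2 * (d - y) by lia.
have -> : d - e = 2 * y by lia.
exact: F_double.
Qed.

(** The boundary [e = 0] forces [n = y^2]. *)
Let sum_U0 : \sum_(t <- U | t.2 == 0) K t =
  \sum_(y <- sqrts n | 0 < y) \sum_(d <- iota 1 (2 * `|y|).-1) F d%:Z y d%:Z.
Proof.
pose V := [seq (y, d%:Z, 0 : int) | y <- [seq y <- sqrts n | 0 < y],
                              d <- iota 1 (2 * `|y|).-1].
transitivity (\sum_(t <- V) K t).
  rewrite -big_filter; apply: perm_big; apply: uniq_perm.
  - exact: filter_uniq.
  - apply: allpairs_uniq_dep => [|x _|]; last by case=> x d [y e] _ _ /= [-> ->].
      exact/filter_uniq/sqrts_uniq.
    exact: iota_uniq.
  - move=> [[y d] e]; rewrite mem_filter mem_U /=.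
    apply/and4P/allpairsPdep => [[/eqP -> d0 w0 /eqP h]|[x [c [h1 h2 [-> -> ->]]]]].
      exists y, (absz d); split; last by congr (_, _, _); lia.
        rewrite mem_filter mem_sqrts; apply/andP; split; first by lia.
        by rewrite -h mulr0 addr0.
      by rewrite mem_iota; lia.
    move: h1 h2; rewrite mem_filter mem_sqrts mem_iota => /andP[x0 h] h2.
    by split; [| lia | lia | rewrite mulr0 addr0].
rewrite big_allpairs_dep big_filter; apply: eq_bigr => y _.
by apply: eq_bigr => d _; rewrite /K /triple_fun /= addr0 ?subr0.
Qed.

(** The left-hand side is the sum of [K] over the image [U] of a change of
    variables. There the terms with [e < 0] cancel, those with [e > 0] give
    half of the sum over [reps n] (the terms with [w = 0] vanish), and those
    with [e = 0] give the last sum. *)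
Lemma liouville_identity :
  2 * rep_sum n (fun i d e => F (e - 2 * i) (d + i) (2 * d + 2 * i - e)) =
  rep_sum n (fun i d e => F (d + e) i (d - e)) +
  2 * \sum_(y <- sqrts n | 0 < y) \sum_(d <- iota 1 (2 * `|y|).-1) F d%:Z y d%:Z.
Proof.
have -> : rep_sum n (fun i d e => F (e - 2 * i) (d + i) (2 * d + 2 * i - e)) =
    \sum_(t <- U) K t.
  rewrite big_map; apply: eq_bigr => -[[i d] e] _; rewrite /K /triple_fun /=.
  by congr (F _ _ _); ring.
have -> : rep_sum n (fun i d e => F (d + e) i (d - e)) = \sum_(t <- reps n) K t.
  by [].
rewrite (@big_split3 _ U snd) (@big_split3 _ (reps n) w).
rewrite sum_U_neg sum_U_pos sum_reps_neg sum_reps0 -sum_U0; ring.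
Qed.

End Liouville.

(** * The theta series of Gauss *)

Definition square_series (c : int -> int) : series :=
  fun n => \sum_(x <- sqrts n) c x.

Definition divisor_series (h : int -> int -> int) : series :=
  fun n => \sum_(p <- dpairs n) h p.1%:Z p.2%:Z.

Lemma square_seriesM c (G : series) n :
  (square_series c * G) n =
  \sum_(x <- ints n | x ^+ 2 <= n%:Z) c x * G (n - `|x| ^ 2)%N.
Proof.
rewrite smulE.
transitivity (\sum_(i < n.+1) \sum_(x <- ints n | x ^+ 2 == i%:Z) c x * G (n - i)%N).
  apply: eq_bigr => i _; rewrite /square_series big_distrl /= -[RHS]big_filter.
  apply: perm_big; apply: uniq_perm.
  - exact: sqrts_uniq.
  - exact/filter_uniq/ints_uniq.
  - move=> x; rewrite mem_sqrts mem_filter mem_ints; apply/esym/andb_idr => /eqP.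
    by rewrite expr2; have := ltn_ord i; nia.
rewrite (exchange_big_dep (fun x : int => x ^+ 2 <= n%:Z)) /=; last first.
  by move=> i x _ /eqP ->; have := ltn_ord i; lia.
apply: eq_bigr => x xn; have xn' : (`|x| ^ 2 < n.+1)%N.
  by rewrite -mulnn; rewrite expr2 in xn; nia.
rewrite (big_pred1 (Ordinal xn')) // => i /=.
rewrite -val_eqE /= -mulnn expr2; lia.
Qed.

(** This turns statements on products of a theta series with a divisor series
    into statements on the sums of Liouville's identity. *)
Lemma square_divisor_series c h n :
  (square_series c * divisor_series h) n = rep_sum n (fun x d e => c x * h d e).
Proof.
rewrite square_seriesM /rep_sum big_allpairs_dep big_filter.
by apply: eq_bigr => x _; rewrite big_distrr.
Qed.

Lemma sum_sqrts_even n (g : int -> int) :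
  (forall x, g (- x) = g x) -> g 0 = 0 ->
  \sum_(x <- sqrts n) g x = 2 * \sum_(x <- sqrts n | 0 < x) g x.
Proof.
move=> gN g0; rewrite (@big_split3 _ _ id) /=.
rewrite [X in _ + (X + _)]big1 ?add0r; last by move=> x /eqP ->.
suff -> : \sum_(x <- sqrts n | x < 0) g x = \sum_(x <- sqrts n | 0 < x) g x by ring.
rewrite [LHS]big_mkcond [RHS]big_mkcond /=.
rewrite (@sum_involution _ _ (fun x => - x)).
- by apply: eq_bigr => x _; rewrite oppr_lt0 gN.
- exact: sqrts_uniq.
- by move=> x; rewrite !mem_sqrts sqrrN.
- by move=> x _; rewrite opprK.
Qed.

Lemma sum_odd_upto s (g : nat -> int) :
  \sum_(d <- iota 1 (2 * s).-1) (if odd d then g d else 0) =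
  \sum_(j < s) g (2 * j + 1)%N.
Proof.
elim: s => [|s IH]; first by rewrite big_nil big_ord0.
rewrite big_ord_recr -IH; case: s {IH} => [|s].
  by rewrite muln1 muln0 /= big_nil add0r big_seq1.
have -> : (2 * s.+2).-1 = ((2 * s.+1).-1 + 2)%N by lia.
have e : (1 + (2 * s.+1).-1 = 2 * s.+1)%N by lia.
rewrite iotaD big_cat e; congr (_ + _).
have: odd (2 * s.+1) = false by rewrite oddM.
move: (2 * s.+1)%N => m om.
by rewrite /= big_cons big_seq1 /= om add0r addn1.
Qed.

Lemma sum_odd_squares (s : nat) :
  \sum_(j < s) (2 * j + 1)%N%:Z = s%:Z ^+ 2.
Proof.
elim: s => [|s IH]; rewrite ?big_ord0 // big_ord_recr /= IH !expr2; lia.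
Qed.

Lemma chi4_odd j : chi4 (2 * j + 1)%N = parity_sign j.
Proof. rewrite /chi4 /parity_sign /oddz; do !case: eqP; lia. Qed.
Lemma parity_signS (s : nat) : parity_sign s.+1 = - parity_sign s.
Proof. by rewrite -addn1 PoszD parity_signD mulrN1. Qed.

Lemma sum_chi4_odd (s : nat) :
  \sum_(j < s) parity_sign j * (2 * j + 1)%N%:Z = - parity_sign s * s%:Z.
Proof.
elim: s => [|s IH]; first by rewrite big_ord0 mulr0.
rewrite big_ord_recr /= IH parity_signS; lia.
Qed.

Lemma sum_chi4_odd_cube (s : nat) :
  \sum_(j < s) parity_sign j * (2 * j + 1)%N%:Z ^+ 3 =
  - parity_sign s * (4 * s%:Z ^+ 3 - 3 * s%:Z).
Proof.
elim: s => [|s IH]; first by rewrite big_ord0 !mulr0.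
rewrite big_ord_recr /= IH parity_signS PoszD PoszM -[s.+1]addn1 PoszD.
ring.
Qed.

(** The theta series [sum (-1)^x q^(x^2)] over all integers [x]. *)
Definition gauss : series := square_series parity_sign.

Lemma gauss0 : gauss 0%N = 1.
Proof.
by rewrite /gauss /square_series big_seq1.
Qed.

(** Liouville's identity for [F x y z = (-1)^y x], restricted to odd [x];
    averaged over the symmetries of [reps n] it becomes a formula for the sum of
    the [(-1)^x d] over odd [e]. *)
Lemma theta_gauss :
  theta gauss = - (2%:R * (gauss * odd_codivisor_sum)).
Proof.
have -> : odd_codivisor_sum = divisor_series (fun d e => if oddz e then d else 0).
  by apply/funext => n; apply: eq_bigr => p _; rewrite oddz_nat.
apply/funext => n; rewrite soppE snatE square_divisor_series.
(* The restriction to odd [x] turns the boundary terms of the identity into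
   sums of consecutive odd numbers, that is, squares. *)
pose F (x y z : int) := if oddz x then parity_sign y * x else 0.
have := @liouville_identity n F.
have FN x y z : F (- x) y z = - F x y z.
  by rewrite /F oddzN; case: ifP => _; ring.
have Fe x y z : F x (- y) (- z) = F x y z by rewrite /F parity_signN.
have F2 x y z : F (2 * x) y (2 * z) = 0.
  by rewrite /F /oddz mulrC modzMl.
move=> /(_ FN Fe F2).
pose G (x d e : int) := parity_sign x * (if oddz e then d else 0).
rewrite -/(rep_sum n G).
set L := fun i d e : int => F (e - 2 * i) _ _.
set R := fun i d e : int => F (d + e) i _.
have : rep_sum n (fun i d e => 2 * L i d e + (- 1 * R i d e + 2 * G i d e)) = 0.
  apply: rep_sum_symm0 => x d e; rewrite /L /R /F /G !parity_signD !parity_signN !oddzD !oddzN.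
  have o2 y : oddz (2 * y) = false by rewrite /oddz mulrC modzMl.
  rewrite !o2 ?addbF; set s := parity_sign x; rewrite /parity_sign.
  by case: (oddz d); case: (oddz e) => /=; ring.
rewrite !rep_sumD !rep_sumZ.
have -> : \sum_(y <- sqrts n | 0 < y) \sum_(d <- iota 1 (2 * `|y|).-1) F d%:Z y d%:Z =
   \sum_(y <- sqrts n | 0 < y) parity_sign y * y ^+ 2.
  apply: eq_bigr => y y0.
  rewrite (eq_bigr (fun d => if odd d then parity_sign y * d%:Z else 0)); last first.
    by move=> d _; rewrite /F oddz_nat.
  rewrite (sum_odd_upto _ (fun d => parity_sign y * d%:Z)) -big_distrr /= sum_odd_squares.
  by congr (_ * _); rewrite !expr2; nia.
have -> : theta gauss n = 2 * \sum_(y <- sqrts n | 0 < y) parity_sign y * y ^+ 2.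
  rewrite -(sum_sqrts_even n (g := fun y => parity_sign y * y ^+ 2)).
  - rewrite /theta /gauss /square_series big_distrr /=.
    by apply: eq_big_seq => x; rewrite mem_sqrts => /eqP ->; rewrite mulrC.
  - by move=> x; rewrite parity_signN sqrrN.
  - by rewrite expr2 !mulr0.
set a := \sum_(y <- _ | _) _; set b := rep_sum _ _; set c := rep_sum _ _.
set d := rep_sum _ _; rewrite -[2%:R]/(2 : int); lia.
Qed.

(** * Sums of six squares *)

Lemma eq_rep_sum n G H :
  (forall x d e, (x, d, e) \in reps n -> G x d e = H x d e) ->
  rep_sum n G = rep_sum n H.
Proof. by move=> h; apply: eq_big_seq => -[[x d] e] /h. Qed.

(** Liouville's identity for [F x y z = chi4 z (-1)^y x y (4 y^2 - x^2)],
    restricted to odd [x]. As [F] is odd in [y], the right-hand sum vanishes. On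
    the left [chi4 z (-1)^y] becomes [- chi4 e], and the part of
    [x y (4 y^2 - x^2)] that is even in [i] is
    [(d e - 6 i^2) (4 d^2 - e^2)]: the factor [4 y^2 - x^2] is chosen for this. *)
Lemma rep_sum_chi4 n :
  rep_sum n (fun x d e => (d * e - 6 * x ^+ 2) * (chi4 e * (4 * d ^+ 2 - e ^+ 2))) =
  \sum_(y <- sqrts n | 0 < y) 3 * y ^+ 2.
Proof.
pose F (x y z : int) :=
  if oddz x then chi4 z * parity_sign y * (x * y * (4 * y ^+ 2 - x ^+ 2)) else 0.
have FN x y z : F (- x) y z = - F x y z.
  by rewrite /F oddzN; case: ifP => _; ring.
have Fe x y z : F x (- y) (- z) = F x y z.
  by rewrite /F parity_signN chi4N; case: ifP => _; ring.
have o2 y : oddz (2 * y) = false by rewrite /oddz mulrC modzMl.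
have F2 x y z : F (2 * x) y (2 * z) = 0 by rewrite /F o2.
have := @liouville_identity n F FN Fe F2.
set G := fun x d e : int => (d * e - 6 * x ^+ 2) * _.
set L := fun i d e : int => F (e - 2 * i) _ _.
set R := fun i d e : int => F (d + e) i _.
have chi4_even x : oddz x = false -> chi4 x = 0.
  by rewrite /oddz /chi4; do !case: eqP; lia.
have : rep_sum n (fun i d e => 2 * L i d e + (- 1 * R i d e + 2 * G i d e)) = 0.
  apply: rep_sum_symm0 => x d e.
  have LE y a b : L y a b = - chi4 b * ((b - 2 * y) * (a + y) *
       (4 * (a + y) ^+ 2 - (b - 2 * y) ^+ 2)).
    rewrite /L /F oddzD oddzN o2 addbF.
    have -> : 2 * a + 2 * y - b = 2 * (a + y) - b by ring.
    by rewrite chi4_reflect; case: ifP => // /chi4_even ->; ring.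
  have RN y a b : R (- y) a b = - R y a b.
    by rewrite /R /F parity_signN; case: ifP => _; ring.
  by rewrite !RN !LE /G; ring.
rewrite !rep_sumD !rep_sumZ.
have -> : \sum_(y <- sqrts n | 0 < y) \sum_(d <- iota 1 (2 * `|y|).-1) F d%:Z y d%:Z =
   - \sum_(y <- sqrts n | 0 < y) 3 * y ^+ 2.
  rewrite -sumrN; apply: eq_bigr => y y0.
  pose g (d : nat) := parity_sign y * y * (4 * y ^+ 2 * (chi4 d * d%:Z) - chi4 d * d%:Z ^+ 3).
  rewrite (eq_bigr (fun d => if odd d then g d else 0)); last first.
    by move=> d _; rewrite /F oddz_nat; case: ifP => // _; rewrite /g; ring.
  rewrite sum_odd_upto /g -big_distrr /= sumrB -big_distrr /=.
  under eq_bigr do rewrite chi4_odd.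
  under [X in _ - X]eq_bigr do rewrite chi4_odd.
  rewrite sum_chi4_odd sum_chi4_odd_cube.
  have -> : `|y|%N%:Z = y by lia.
  have s2 : parity_sign y * parity_sign y = 1 by rewrite /parity_sign; case: ifP.
  transitivity (- (3 * y ^+ 2) * (parity_sign y * parity_sign y)); first by ring.
  by rewrite s2 mulr1.
set a := \sum_(y <- _ | _) _; set b := rep_sum _ _; set c := rep_sum _ _.
set d := rep_sum _ _; lia.
Qed.

(** Summed over [d e = n] this is, up to the sign [(-1)^n], the formula
    [16 sum chi4(n/d) d^2 - 4 sum chi4(d) d^2] of Jacobi. *)
Definition six_squares_weight (d e : int) : int :=
  4 * parity_sign (d * e) * (chi4 e * (4 * d ^+ 2 - e ^+ 2)).

Definition six_squares : series := 1 + divisor_series six_squares_weight.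

Lemma theta_square_series c :
  theta (square_series c) = square_series (fun x => c x * x ^+ 2).
Proof.
apply/funext => n; rewrite /theta /square_series big_distrr /=.
by apply: eq_big_seq => x; rewrite mem_sqrts => /eqP ->; rewrite mulrC.
Qed.

Lemma theta_divisor_series h :
  theta (divisor_series h) = divisor_series (fun d e => d * e * h d e).
Proof.
apply/funext => n; rewrite /theta /divisor_series big_distrr /=.
by apply: eq_big_seq => -[d e]; rewrite mem_dpairs => /andP[_ /eqP <-]; rewrite PoszM.
Qed.

(** At [q^n] the divisor sums on the two sides differ by [4 (-1)^n] times the
    sum evaluated in [rep_sum_chi4], because [(-1)^x (-1)^(d e) = (-1)^n]; its
    value matches the contribution of the constant term 1 of [six_squares]. *)
Lemma theta_six_squares :
  gauss * theta six_squares = 6%:R * six_squares * theta gauss.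
Proof.
have -> : 6%:R * six_squares * theta gauss =
    6%:R * (theta gauss * divisor_series six_squares_weight) + 6%:R * theta gauss.
  by rewrite /six_squares; ring.
rewrite thetaD theta1 add0r theta_divisor_series theta_square_series.
apply/funext => n; rewrite saddE !snatE !square_divisor_series.
have e6 : square_series (fun x => parity_sign x * x ^+ 2) n =
    2 * \sum_(y <- sqrts n | 0 < y) parity_sign n * y ^+ 2.
  rewrite /square_series -(sum_sqrts_even n (g := fun y => parity_sign n * y ^+ 2)).
  - apply: eq_big_seq => x; rewrite mem_sqrts => /eqP <-; congr (_ * _).
    rewrite /parity_sign /oddz expr2; case: eqP; case: eqP => //; nia.
  - by move=> x; rewrite sqrrN.
  - by rewrite expr2 !mulr0.
have := rep_sum_chi4 n; set G := rep_sum n _.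
move=> hG; have : rep_sum n (fun x d e => parity_sign x * (d * e * six_squares_weight d e)) =
   6 * rep_sum n (fun x d e => parity_sign x * x ^+ 2 * six_squares_weight d e) +
   4 * parity_sign n * G.
  rewrite -!rep_sumZ -rep_sumD; apply: eq_rep_sum => x d e.
  rewrite mem_reps => /and3P[_ _ /eqP <-]; rewrite parity_signD.
  have -> : parity_sign (x ^+ 2) = parity_sign x.
    rewrite /parity_sign /oddz expr2; case: eqP; case: eqP => //; nia.
  rewrite /six_squares_weight; ring.
move=> ->; rewrite hG e6 -!big_distrr /= -[6%:R]/(6 : int); ring.
Qed.

Lemma theta_eq0 (f : series) : f 0%N = 1 -> theta f = 0 -> f = 1.
Proof.
move=> f0 h; apply/funext => -[|n]; first by rewrite f0.
have := congr1 (fun g : series => g n.+1) h; rewrite /theta s0E => /eqP.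
by rewrite mulf_eq0 => /eqP.
Qed.

Lemma thetaX (f : series) n : theta (f ^+ n.+1) = n.+1%:R * f ^+ n * theta f.
Proof.
elim: n => [|n IH]; first by rewrite expr1 expr0 !mul1r.
rewrite exprS thetaM IH -[n.+2]addn1 natrD !exprS; move: n.+1%:R => c; ring.
Qed.

Lemma smul0E (f g : series) : (f * g) 0%N = f 0%N * g 0%N.
Proof. by rewrite smulE big_ord1. Qed.
Lemma sexp0E (f : series) n : (f ^+ n) 0%N = f 0%N ^+ n.
Proof. by elim: n => [//|n IH]; rewrite !exprS smul0E IH. Qed.

(** The logarithmic derivatives of the two factors are opposite. *)
Lemma gauss_overpartition : gauss * overpartition_gf = 1.
Proof.
apply: theta_eq0; first by rewrite smul0E gauss0.
by rewrite thetaM theta_gauss theta_overpartition_gf; ring.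
Qed.

(** The differential equation says that the logarithmic derivative of
    [six_squares] is that of [gauss^6]. Dividing by [gauss] is multiplying by the
    overpartition series. *)
Lemma six_squaresE : six_squares = gauss ^+ 6.
Proof.
set P := overpartition_gf; have gP : gauss * P = 1 := gauss_overpartition.
suff eP : six_squares * P ^+ 6 = 1.
  transitivity (six_squares * P ^+ 6 * gauss ^+ 6); last by rewrite eP mul1r.
  transitivity (six_squares * (gauss * P) ^+ 6); last by ring.
  by rewrite gP expr1n mulr1.
apply: theta_eq0.
  rewrite smul0E sexp0E.
  have -> : P 0%N = 1 by [].
  by rewrite expr1n mulr1 /six_squares saddE /divisor_series big_nil.
apply: (@series_mulI gauss); first exact: gauss0.
rewrite mulr0 thetaM thetaX mulrDr.
have tP : gauss * theta P = - (P * theta gauss).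
  have := congr1 theta gP; rewrite thetaM theta1 => h.
  by apply/eqP; rewrite -subr_eq0 opprK -h; apply/eqP; ring.
transitivity (P ^+ 6 * (gauss * theta six_squares) +
   6%:R * six_squares * P ^+ 5 * (gauss * theta P)); first by ring.
by rewrite tP theta_six_squares; ring.
Qed.

(** * Power series modulo 3 and 9 *)

Definition congr_mod (m : nat) (f g : series) : Prop :=
  exists h : series, f = g + m%:R * h.

Lemma congr_modP m f g :
  (0 < m)%N -> (forall n, (m%:Z %| f n - g n)%Z) -> congr_mod m f g.
Proof.
move=> m0 h; exists (fun n => ((f n - g n) %/ m%:Z)%Z).
apply/funext => n; rewrite saddE snatE natz mulrC divzK //; ring.
Qed.

(** The substitution of [q^3] for [q]. *)
Definition dilate3 (f : series) : series :=
  fun n => if (3 %| n)%N then f (n %/ 3)%N else 0.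

Definition sconst (c : int) : series := fun n => if n == 0%N then c else 0.

Lemma sconstM c f n : (sconst c * f) n = c * f n.
Proof.
rewrite smulE big_ord_recl subn0 big1 ?addr0 // => i _.
by rewrite /sconst /= mul0r.
Qed.

(** Frobenius modulo 3. Splitting off the constant term, [f = c + q g], gives
    [f^3 = c^3 + q^3 g^3] modulo 3, so that the claim for [f] at [n] reduces to
    Fermat's theorem for [c] and the claim for [g] at [n - 3]. *)
Lemma cube_dilate3 f : congr_mod 3 (f ^+ 3) (dilate3 f).
Proof.
apply: congr_modP => // n; elim/ltn_ind: n f => n IH f.
pose g : series := fun n => f n.+1; pose X := monom 1.
have fE : f = sconst (f 0%N) + X * g.
  by apply/funext => -[|m]; rewrite saddE monomM /= ?addr0 // /g subn1 /= add0r.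
set c := sconst (f 0%N) in fE.
have -> : f ^+ 3 = c * (c * c) + 3%:R * (c * c * X * g + c * (X * g) ^+ 2)
     + X * (X * (X * g ^+ 3)) by rewrite fE; ring.
have cM h m : (c * h) m = f 0%N * h m := sconstM _ _ _.
rewrite !saddE snatE cM cM !monomM /dilate3 -[3%:R]/(3 : int).
move: ((_ + _ : series) n) => K.
case: n IH => [|[|[|n]]] IH /=.
- rewrite addr0 div0n -[c 0%N]/(f 0%N); set z := f 0%N.
  have : (3 %| z * (z * z) - z)%Z.
    have [q hq] : exists q, z = 3 * q \/ z = 3 * q + 1 \/ z = 3 * q + 2.
      by exists (z %/ 3)%Z; lia.
    apply/dvdzP; case: hq => [->|[->|->]].
    + by exists (9 * q ^+ 3 - q); ring.
    + by exists (9 * q ^+ 3 + 9 * q ^+ 2 + 2 * q); ring.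
    + by exists (9 * q ^+ 3 + 18 * q ^+ 2 + 11 * q + 2); ring.
  lia.
- rewrite -[c 1%N]/(0 : int) !mulr0; lia.
- rewrite -[c 2%N]/(0 : int) !mulr0; lia.
- rewrite -[c _]/(0 : int) !mulr0 !subn1 /=.
  have := IH n ltac:(lia) g; rewrite /dilate3 /g.
  have -> : (3 %| n.+3)%N = (3 %| n)%N by lia.
  have -> : (n.+3 %/ 3 = (n %/ 3).+1)%N by lia.
  by case: ifP => _; lia.
Qed.

(** Residues of exponents modulo 3 grade the ring of series; [supp3] is
    homogeneity and [part3] the projection on a component. *)
Definition supp3 (r : nat) (f : series) : Prop :=
  forall n, (n %% 3 != r)%N -> f n = 0.
Definition part3 (r : nat) (f : series) : series :=
  fun n => if (n %% 3 == r)%N then f n else 0.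

Lemma supp3_part r f : supp3 r (part3 r f).
Proof. by move=> n /negbTE h; rewrite /part3 h. Qed.

Lemma supp3M r s f g : supp3 r f -> supp3 s g -> supp3 ((r + s) %% 3) (f * g).
Proof.
move=> hf hg n nrs; rewrite smulE big1 // => i _.
case: (eqVneq (i %% 3)%N r) => ir; last by rewrite hf ?mul0r.
case: (eqVneq ((n - i) %% 3)%N s) => js; last by rewrite hg ?mulr0.
by move: nrs; have := ltn_ord i; lia.
Qed.

Lemma part3D r f g : part3 r (f + g) = part3 r f + part3 r g.
Proof. by apply/funext => n; rewrite /part3 !saddE; case: ifP. Qed.

Lemma part3Z r m f : part3 r (m%:R * f) = m%:R * part3 r f.
Proof. by apply/funext => n; rewrite snatE /part3 snatE; case: ifP; rewrite ?mulr0. Qed.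

Lemma part3_id r f : supp3 r f -> part3 r f = f.
Proof.
by move=> h; apply/funext => n; rewrite /part3; case: (boolP (_ == _)) => // /h ->.
Qed.

Lemma part3_eq0 r s f : supp3 s f -> s != r -> part3 r f = 0.
Proof.
move=> h sr; apply/funext => n; rewrite /part3; case: eqP => // e.
by rewrite h // e eq_sym.
Qed.

Lemma part3M r u f : supp3 0 u -> part3 r (u * f) = u * part3 r f.
Proof.
move=> hu; apply/funext => n; rewrite /part3 !smulE.
case: eqP => nr.
  apply: eq_bigr => i _; case: (eqVneq (i %% 3)%N 0%N) => i0; last by rewrite hu ?mul0r.
  by rewrite ifT //; have := ltn_ord i; lia.
rewrite big1 // => i _; case: (eqVneq (i %% 3)%N 0%N) => i0; last by rewrite hu ?mul0r.
by rewrite ifF ?mulr0 //; apply/negbTE; have := ltn_ord i; lia.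
Qed.

Lemma gauss_dissection : gauss = part3 0 gauss + part3 1 gauss.
Proof.
apply/funext => n; rewrite saddE /part3.
have [n0|[n1|n2]] : (n %% 3 = 0 \/ n %% 3 = 1 \/ n %% 3 = 2)%N by lia.
- by rewrite n0 /= addr0.
- by rewrite n1 /= add0r.
rewrite n2 /= addr0 /gauss /square_series big1_seq // => x.
rewrite mem_sqrts => /andP[_ /eqP]; rewrite expr2 => e.
have : (x %% 3 = 0)%Z \/ (x %% 3 = 1)%Z \/ (x %% 3 = 2)%Z by lia.
have := divz_eq x 3; set q := (x %/ 3)%Z; nia.
Qed.

Lemma root_dvd3 (x : int) (n : nat) :
  x * x = n%:Z -> (3 %| n)%N -> exists y, x = 3 * y.
Proof.
move=> e n3; exists (x %/ 3)%Z.
have : (x %% 3 = 0)%Z \/ (x %% 3 = 1)%Z \/ (x %% 3 = 2)%Z by lia.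
have := divz_eq x 3; set q := (x %/ 3)%Z; nia.
Qed.

(** If 3 divides [x^2] then 9 does, and [(-1)^(3 x) = (-1)^x]. *)
Lemma part3_gauss : part3 0 gauss = dilate3 (dilate3 gauss).
Proof.
apply/funext => n; rewrite /part3 /dilate3.
case: eqP => [n0|n0]; last by rewrite ifF //; apply/negbTE; lia.
have -> : (3 %| n)%N by lia.
case: ifP => n9.
  have [m ->] : exists m, n = (9 * m)%N by exists (n %/ 9)%N; lia.
  have -> : (9 * m %/ 3 %/ 3 = m)%N by lia.
  rewrite /gauss /square_series.
  have e : perm_eq (sqrts (9 * m)) [seq 3 * x | x <- sqrts m].
    apply: uniq_perm; first exact: sqrts_uniq.
      by rewrite map_inj_uniq ?sqrts_uniq // => x y; lia.
    move=> x; rewrite mem_sqrts; apply/eqP/mapP => [|[y + ->]].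
      rewrite expr2 => e; have [|y yE] := root_dvd3 e; first by lia.
      by exists y => //; rewrite mem_sqrts expr2; apply/eqP; move: e; rewrite yE; lia.
    rewrite mem_sqrts expr2 => /eqP e; rewrite expr2; lia.
  rewrite (perm_big _ e) big_map; apply: eq_bigr => x _.
  by rewrite /parity_sign /oddz; do 2!case: eqP => //; lia.
rewrite /gauss /square_series big1_seq // => x.
rewrite mem_sqrts => /andP[_ /eqP]; rewrite expr2 => e.
have [|y yE] := root_dvd3 e; first by lia.
by move: e; rewrite yE; lia.
Qed.

(** The identity [g^3 = D + 3 A C g] and [p g^2 = 1] make [D^3 p] and [g^6]
    polynomial in [A], [C], [D] modulo 9, whence their homogeneous components.
    The factor [D^3] has constant term 1 and can be cancelled in the end. *)
Lemma pp_six_squares n : (n %% 3 = 2)%N ->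
  (9 %| 2 * (pp n)%:Z - six_squares n)%Z.
Proof.
move=> n2; rewrite pp_gf six_squaresE.
set p := overpartition_gf ^+ 2; set g := gauss.
have pg : p * g ^+ 2 = 1.
  by rewrite /p -exprMn [_ * g]mulrC gauss_overpartition expr1n.
set A := part3 0 gauss; set C := part3 1 gauss.
have gAC : g = A + C := gauss_dissection.
set D := A ^+ 3 + C ^+ 3.
have sA : supp3 0 A := supp3_part _.
have sC : supp3 1 C := supp3_part _.
have sA2 : supp3 0 (A * A) := supp3M sA sA.
have sC2 : supp3 2 (C * C) := supp3M sC sC.
have sD : supp3 0 D.
  move=> k k0; rewrite /D saddE !exprSr !mul1r.
  by rewrite (supp3M sA2 sA) // (supp3M sC2 sC).
have sD2 : supp3 0 (D * D) := supp3M sD sD.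
have sD3 : supp3 0 (D ^+ 3).
  by rewrite !exprSr expr0 mul1r; apply: supp3M sD2 sD.
have g3 : g ^+ 3 = D + 3%:R * (A * C * g) by rewrite /D gAC; ring.
(* [D^3 = (g^3 - 3 A C g)^3] is [g^9] modulo 9, and [p * g^9 = g^7]. *)
have [K1 pD] : exists K, D ^+ 3 * p =
    A * (D * D) + C * (D * D) + 6%:R * (A * A * A * C * D)
    + 12%:R * (D * (A * A * (C * C))) + 6%:R * (D * (A * (C * C * C))) + 9%:R * K.
  pose W := A * C * g; pose V := g ^+ 3.
  exists (A ^+ 2 * C ^+ 2 * g ^+ 3 + p * (3%:R * V * W ^+ 2 - V ^+ 2 * W - 3%:R * W ^+ 3)).
  transitivity ((p * g ^+ 2) * (g * V ^+ 2) +
     9%:R * (p * (3%:R * V * W ^+ 2 - V ^+ 2 * W - 3%:R * W ^+ 3))).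
    have -> : D = V - 3%:R * W by rewrite /V g3 /W; ring.
    by rewrite /V; ring.
  rewrite pg mul1r; set T := p * _.
  by rewrite /V g3 gAC /D; ring.
have [K2 gE] : exists K, g ^+ 6 =
    D * D + 6%:R * (A * A * C * D) + 6%:R * (D * (A * (C * C))) + 9%:R * K.
  exists (A ^+ 2 * C ^+ 2 * g ^+ 2).
  transitivity ((g ^+ 3) ^+ 2); first by ring.
  by rewrite g3 gAC; ring.
(* Modulo 3, [D] is [g^3], so [D^3] is [g] at [q^9], which is [A]. *)
have [J DA] : exists J, D ^+ 3 = A + 3%:R * J.
  have [u1 e1] := cube_dilate3 g.
  have [u2 e2] := cube_dilate3 (dilate3 g).
  rewrite -/A -part3_gauss -/g -/A in e2.
  set h := dilate3 g in e1 e2; set W := A * C * g in g3.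
  exists (u2 + (h + 3%:R * u1 - 3%:R * W) ^+ 2 * (u1 - W)
     + (h + 3%:R * u1 - 3%:R * W) * h * (u1 - W) + h ^+ 2 * (u1 - W)).
  have -> : D = h + 3%:R * u1 - 3%:R * W by rewrite -e1 g3; ring.
  transitivity (h ^+ 3 + 3%:R * ((h + 3%:R * u1 - 3%:R * W) ^+ 2 * (u1 - W)
     + (h + 3%:R * u1 - 3%:R * W) * h * (u1 - W) + h ^+ 2 * (u1 - W))); first by ring.
  by rewrite e2; ring.
have sC3 : supp3 0 (C * C * C) := supp3M sC2 sC.
have s0 (f1 f2 : series) : supp3 0 f1 -> supp3 0 f2 -> supp3 0 (f1 * f2) := @supp3M 0 0 f1 f2.
have pD2 := congr1 (part3 2) pD.
rewrite !(part3D, part3Z, part3M _ _ sD3) in pD2.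
have z1 : part3 2 (A * (D * D)) = 0 by apply: (@part3_eq0 _ 0) => //; exact: s0.
have z2 : part3 2 (C * (D * D)) = 0 by apply: (@part3_eq0 _ 1) => //; exact: supp3M sC sD2.
have z3 : part3 2 (A * A * A * C * D) = 0.
  apply: (@part3_eq0 _ 1) => //; exact: (supp3M (supp3M (s0 _ _ sA2 sA) sC) sD).
have z4 : part3 2 (D * (A * A * (C * C))) = D * (A * A * (C * C)).
  apply: part3_id; exact: (supp3M sD (supp3M sA2 sC2)).
have z5 : part3 2 (D * (A * (C * C * C))) = 0.
  apply: (@part3_eq0 _ 0) => //; exact: s0 sD (s0 _ _ sA sC3).
rewrite z1 z2 z3 z4 z5 in pD2.
have gE2 := congr1 (part3 2) gE.
rewrite !(part3D, part3Z) in gE2.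
have y1 : part3 2 (D * D) = 0 by exact: part3_eq0 sD2 _.
have y2 : part3 2 (A * A * C * D) = 0.
  apply: (@part3_eq0 _ 1) => //; exact: (supp3M (supp3M sA2 sC) sD).
have y3 : part3 2 (D * (A * (C * C))) = D * (A * (C * C)).
  apply: part3_id; exact: (supp3M sD (supp3M sA sC2)).
rewrite y1 y2 y3 in gE2.
suff : forall m, (9 %| (2%:R * part3 2 p - part3 2 (g ^+ 6)) m)%Z.
  by move=> /(_ n); rewrite saddE soppE snatE /part3 n2.
have D0 : (D ^+ 3) 0%N = 1.
  by rewrite sexp0E /D saddE !sexp0E /A /C /part3 /= /g gauss0.
apply: (dvdz_cancel D0) => m.
have -> : D ^+ 3 * (2%:R * part3 2 p - part3 2 (g ^+ 6)) =
  9%:R * (2%:R * part3 2 K1 - D ^+ 3 * part3 2 K2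
    + 2%:R * (D * A * A * C * C) - 2%:R * (D * A * C * C * J)).
  rewrite mulrBr gE2.
  transitivity (2%:R * (D ^+ 3 * part3 2 p) - D ^+ 3 * (6%:R * (D * (A * (C * C)))
     + 9%:R * part3 2 K2)); first by ring.
  rewrite pD2 DA; ring.
by rewrite snatE dvdz_mulr.
Qed.

(** * The coefficients at twice a power of 13 *)

Lemma sum_odd_dpairs k (h : nat -> nat -> int) :
  (forall d e, ~~ odd e -> h d e = 0) ->
  \sum_(p <- dpairs (2 * 13 ^ k)) h p.1 p.2 =
  \sum_(j < k.+1) h (2 * 13 ^ (k - j))%N (13 ^ j)%N.
Proof.
move=> h0; rewrite /dpairs big_map /= (bigID odd) /= [X in _ + X]big1 ?addr0; last first.
  by move=> e oe; rewrite h0.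
rewrite -big_filter -filter_predI.
have e : perm_eq [seq e <- iota 1 (2 * 13 ^ k) | predI odd (dvdn^~ (2 * 13 ^ k)%N) e]
    [seq (13 ^ j)%N | j <- iota 0 k.+1].
  apply: uniq_perm; first exact/filter_uniq/iota_uniq.
    by rewrite map_inj_uniq ?iota_uniq // => i j /eqP; rewrite eqn_exp2l // => /eqP.
  move=> x; rewrite mem_filter mem_iota; apply/idP/mapP => [/andP[/andP[ox xd] _]|[j + ->]].
    have {}xd : (x %| 13 ^ k)%N by move: xd; rewrite Gauss_dvdr // coprimen2.
    have /dvdn_pfactor[//|m mk ->] := xd.
    by exists m => //; rewrite mem_iota; lia.
  rewrite mem_iota /= => jk; rewrite oddX orbT /=.
  have -> : (13 ^ j %| 2 * 13 ^ k)%N by rewrite dvdn_mull // dvdn_exp2l.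
  have := expn_gt0 13 j; have : (13 ^ j <= 13 ^ k)%N by rewrite leq_exp2l.
  lia.
rewrite (perm_big _ e) big_map.
rewrite -(big_mkord xpredT (fun j => h (2 * 13 ^ (k - j))%N (13 ^ j)%N)).
apply: eq_big_seq => j; rewrite mem_iota /= add0n => jk; congr (h _ _).
rewrite -{1}(@subnK j k) // expnD mulnA mulnK // expn_gt0 //.
Qed.

Lemma six_squares_13 k :
  exists m : int, six_squares (2 * 13 ^ k)%N = 6 * (k.+1)%:Z + 9 * m.
Proof.
have n0 : (0 < 2 * 13 ^ k)%N by rewrite muln_gt0 expn_gt0.
have -> : six_squares (2 * 13 ^ k)%N = 60 * \sum_(j < k.+1) (169 ^ j)%N%:Z.
  rewrite /six_squares saddE s1E (gtn_eqF n0) add0r /divisor_series.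
  rewrite (@sum_odd_dpairs _ (fun d e => six_squares_weight d e)); last first.
    move=> d e oe; rewrite /six_squares_weight.
    have -> : chi4 e = 0 by move: oe; rewrite /chi4; do !case: eqP; lia.
    by rewrite mul0r mulr0.
  transitivity (64 * \sum_(j < k.+1) (169 ^ (k - j))%N%:Z
                - 4 * \sum_(j < k.+1) (169 ^ j)%N%:Z).
    rewrite !big_distrr -sumrB; apply: eq_bigr => j _; rewrite /six_squares_weight.
    have -> : parity_sign ((2 * 13 ^ (k - j))%N%:Z * (13 ^ j)%N%:Z) = 1.
      by rewrite /parity_sign /oddz PoszM -mulrA mulrC modzMl.
    have -> : chi4 (13 ^ j)%N = 1.
      elim: (j : nat) => // i; rewrite expnS /chi4; do !case: eqP; lia.
    have e i : (169 ^ i)%N%:Z = (13 ^ i)%N%:Z ^+ 2.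
      by rewrite expr2 -PoszM mulnn -expnM mulnC expnM.
    by rewrite !e PoszM; ring.
  have -> : \sum_(j < k.+1) (169 ^ (k - j))%N%:Z = \sum_(j < k.+1) (169 ^ j)%N%:Z.
    by rewrite [RHS](reindex_inj rev_ord_inj) /=; apply: eq_bigr => j _; rewrite subSS.
  ring.
elim: k {n0} => [|k [m IH]]; first by rewrite big_ord1; exists 6.
have [q hq] : exists q : nat, (169 ^ k.+1 = 1 + 3 * q)%N.
  have : (169 ^ k.+1 %% 3 = 1)%N by rewrite -modnXm exp1n.
  by exists (169 ^ k.+1 %/ 3)%N; lia.
rewrite big_ord_recr mulrDr IH /= hq; exists (m + 6 + 20 * q%:Z).
lia.
Qed.

Local Close Scope ring_scope.

Theorem theorem5p2 (k : nat) : pp (2 * 13 ^ k) = 3 * (k + 1) %[mod 9].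
Proof.
have n2 : ((2 * 13 ^ k) %% 3 = 2)%N by rewrite -modnMmr -modnXm exp1n.
have := pp_six_squares n2; have [m ->] := six_squares_13 k.
set z := pp _; lia.
Qed.
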